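(* Let $S_1,S_2,S_3,S_4,S_5$ be the arcs of the bridge system, whose minimal cut sets are $\{S_1,S_2\}$, $\{S_4,S_5\}$, $\{S_2,S_4\}$, $\{S_1,S_3,S_5\}$, and let $R_i(t)$ denote the reliability of the arc $S_i$ for $i=1,\dots,5$, the arcs functioning or failing independently of each other. Then the reliability $R_{Mc}(t)$ of the whole system is $$R_{Mc}(t)=R_1(t)R_4(t)+R_2(t)R_5(t)+R_2(t)R_3(t)R_4(t)-R_1(t)R_2(t)R_3(t)R_4(t)-R_1(t)R_2(t)R_4(t)R_5(t)-R_2(t)R_3(t)R_4(t)R_5(t)+R_1(t)R_2(t)R_3(t)R_4(t)R_5(t).$$
   Context: A system is modelled as a directed network with a source node and a sink node; its components are the arcs. The failure of a component is equivalent to the removal of the corresponding arc. The system is successful if there is a path of non-failed arcs from the source to the sink, and failed otherwise. A set of components is a cut if, whenever all components in it fail, the system fails even if all other components are successful; a minimal cut is a cut such that removing any one component from it yields a set which is not a cut. Thus the system fails if and only if all components of some minimal cut fail. The bridge system has five arcs $S_1,\dots,S_5$: from the source there are arcs $S_1$ to a node $X$ and $S_2$ to a node $Y$; arc $S_3$ goes from $Y$ to $X$; arc $S_4$ goes from $X$ to the sink; arc $S_5$ goes from $Y$ to the sink. Its minimal cut sets are $\{S_1,S_2\}$, $\{S_4,S_5\}$, $\{S_2,S_4\}$, $\{S_1,S_3,S_5\}$. For $t\ge 0$, $R_i(t)\in[0,1]$ is the probability that the component $S_i$ is functional on the whole interval $[0,t]$ (a component that has failed stays failed). The reliability $R_{Mc}(t)$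 of the system is the probability that there exists a path from the source to the sink all of whose arcs are functional on $[0,t]$. *)

(* Defs.v *)
From HB Require Import structures.
From mathcomp Require Import all_boot all_order all_algebra.
From mathcomp Require Import all_classical all_reals all_analysis.

Set Implicit Arguments.
Unset Strict Implicit.
Unset Printing Implicit Defensive.

Import Order.TTheory GRing.Theory Num.Theory.
Local Open Scope classical_set_scope.
Local Open Scope ring_scope.

(* The components of a network are its arcs. *)
Record network := Network {
  node : Type;
  component : finType;
  arc_tail : component -> node;
  arc_head : component -> node;
  source : node;
  sink : node }.

(* [p] lists the consecutive arcs of a directed path from [x] to [y]. *)
Fixpoint is_path (N : network) (x : node N) (p : seq (component N)) (y : node N) :
    Prop :=
  if p is e :: p' then arc_tail e = x /\ is_path (arc_head e) p' y else x = y.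

(* [A] is the set of non-failed arcs. *)
Definition successful (N : network) (A : set (component N)) : Prop :=
  exists2 p : seq (component N),
    is_path (source N) p (sink N) & forall e, e \in p -> A e.

Definition cut (N : network) (C : set (component N)) : Prop := ~ successful (~` C).

Definition minimal_cut (N : network) (C : set (component N)) : Prop :=
  cut C /\ forall e, C e -> ~ cut (C `\ e).

Inductive bridge_node := Src | NodeX | NodeY | Snk.

Inductive bridge_arc := S1 | S2 | S3 | S4 | S5.

Definition ord_of_bridge_arc (e : bridge_arc) : 'I_5 :=
  match e with
  | S1 => inord 0 | S2 => inord 1 | S3 => inord 2 | S4 => inord 3
  | S5 => inord 4
  end.

Definition bridge_arc_of_ord (i : 'I_5) : bridge_arc :=
  match val i with 0 => S1 | 1 => S2 | 2 => S3 | 3 => S4 | _ => S5 end%N.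

Lemma ord_of_bridge_arcK : cancel ord_of_bridge_arc bridge_arc_of_ord.
Proof. by case; rewrite /bridge_arc_of_ord /= inordK. Qed.

HB.instance Definition _ :=
  Finite.copy bridge_arc (can_type ord_of_bridge_arcK).

Definition bridge_tail (e : bridge_arc) : bridge_node :=
  match e with S1 => Src | S2 => Src | S3 => NodeY | S4 => NodeX | S5 => NodeY end.

Definition bridge_head (e : bridge_arc) : bridge_node :=
  match e with S1 => NodeX | S2 => NodeY | S3 => NodeX | S4 => Snk | S5 => Snk end.

Definition bridge : network :=
  @Network bridge_node bridge_arc bridge_tail bridge_head Src Snk.

Lemma successful_bridge (A : set bridge_arc) :
  @successful bridge A <->
  [\/ A S1 /\ A S4, A S2 /\ A S5 | [/\ A S2, A S3 & A S4]].
Proof.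
split=> [[p pp Ap]|].
  case: p pp Ap => [|e1 [|e2 [|e3 p]]] pp Ap.
  - by [].
  - by case: e1 pp {Ap}; simpl; intuition discriminate.
  - case: e1 e2 pp Ap => [] [] pp Ap;
      try (by exfalso; move: pp; simpl; intuition discriminate).
    + by constructor 1; split; apply: Ap; rewrite !inE eqxx ?orbT.
    + by constructor 2; split; apply: Ap; rewrite !inE eqxx ?orbT.
  - case: e1 e2 e3 pp Ap => [] [] [] pp Ap;
      try (by exfalso; move: pp; simpl; intuition discriminate).
    by constructor 3; split; apply: Ap; rewrite !inE eqxx ?orbT.
case=> [[a1 a4]|[a2 a5]|[a2 a3 a4]].
- by exists ([:: S1; S4] : seq (component bridge)) => // e; rewrite !inE => /orP[]/eqP->.
- by exists ([:: S2; S5] : seq (component bridge)) => // e; rewrite !inE => /orP[]/eqP->.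
- by exists ([:: S2; S3; S4] : seq (component bridge)) => // e;
    rewrite !inE => /or3P[]/eqP->.
Qed.

Lemma cut_bridge (C : set bridge_arc) :
  @cut bridge C <->
  [/\ C S1 \/ C S4, C S2 \/ C S5 & [\/ C S2, C S3 | C S4]].
Proof.
rewrite /cut successful_bridge /setC /=.
have [[c1|c1] [c2|c2] [c3|c3] [c4|c4] [c5|c5]] :
    [/\ C S1 \/ ~ C S1, C S2 \/ ~ C S2, C S3 \/ ~ C S3, C S4 \/ ~ C S4
      & C S5 \/ ~ C S5] by split; exact: EM.
all: split; [move=> h; split; apply: contrapT => h'; apply: h; firstorder
            | by case=> ? ? ?; firstorder].
Qed.

Lemma minimal_cut_bridge (C : set bridge_arc) :
  @minimal_cut bridge C <->
  [\/ C = [set S1; S2], C = [set S4; S5], C = [set S2; S4]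
    | C = [set S1; S3; S5]].
Proof.
have minE (D : set bridge_arc) :
    @cut bridge D -> D `<=` C -> @minimal_cut bridge C -> C = D.
  move=> cD DC [_ minC]; apply/seteqP; split=> // e Ce.
  apply: contrapT => De; apply: (minC e Ce); move: cD; rewrite !cut_bridge.
  have DCe f : D f -> (C `\ e) f.
    by move=> Df; split; [exact: DC | move=> fe; apply: De; rewrite -fe].
  by move=> [h1 h2 h3]; split;
    [case: h1 | case: h2 | case: h3] => /DCe ?;
    by [left | right | constructor 1 | constructor 2 | constructor 3].
split=> [mC|].
  have [cC _] := mC; have [h1 h2 h3] := (cut_bridge C).1 cC.
  have [c2|nc2] := EM (C S2).
    case: h1 => [c1|c4]; [constructor 1 | constructor 3]; apply: minE => //.
    + by apply/cut_bridge; split; [left; left | left; right | constructor 1; right].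
    + by move=> e [->|->].
    + by apply/cut_bridge; split; [right; right | left; left | constructor 1; left].
    + by move=> e [->|->].
  case: h2 => // c5.
  have [c4|nc4] := EM (C S4).
    constructor 2; apply: minE => //; last by move=> e [->|->].
    by apply/cut_bridge; split; [right; left | right; right | constructor 3; left].
  case: h1 => // c1; case: h3 => // c3.
  constructor 4; apply: minE => //; last by move=> e [[->|->]|->].
  by apply/cut_bridge; split;
    [left; left; left | right; right | constructor 2; left; right].
have cutE (D : set bridge_arc) : @cut bridge D <->
    (D S1 \/ D S4) /\ (D S2 \/ D S5) /\ (D S2 \/ D S3 \/ D S4).
  rewrite cut_bridge; split=> [[? ? [?|?|?]]|[? [? h]]]; [tauto.. |].
  by split=> //; case: h => [|[]]; [constructor 1 | constructor 2 | constructor 3].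
case=> ->; (split; first by rewrite cutE /=; tauto).
all: case; rewrite cutE /setD /=; intuition discriminate.
Qed.

(* Mutual independence: the product rule for every finite subfamily. *)
Definition mutually_independent d (T : measurableType d) (R : realType)
    (P : probability T R) (I : finType) (E : I -> set T) : Prop :=
  forall J : {set I},
    P (\bigcap_(i in [set` J]) E i) = (\prod_(i in J) P (E i))%E.

Section Reliability.
Context d (T : measurableType d) (R : realType) (P : probability T R).
Variable N : network.
(* [up e s] is the event that arc [e] is functional at the instant [s]. *)
Variable up : component N -> R -> set T.

Definition functional_on (e : component N) (t : R) : set T :=
  [set w | forall s, 0 <= s <= t -> up e s w].

Definition arc_reliability (e : component N) (t : R) : R :=
  fine (P (functional_on e t)).

Definition system_reliability (t : R) : R :=
  fine (P [set w | successful [set e | functional_on e t w]]).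

End Reliability.

(* Main.v *)
(* For t >= 0 the event that an arc works on the whole of [0, t] is just [up e t],
since failed arcs stay failed; in particular it is measurable. The system works
iff one of the source-sink paths S1 S4, S2 S5, S2 S3 S4 works, and the formula is
inclusion-exclusion over these three events, independence turning the
probability of each intersection into a product. *)
Require Import Defs.
From mathcomp Require Import all_boot all_order all_algebra.
From mathcomp Require Import all_classical all_reals all_analysis.
From mathcomp Require Import ring.

Import Order.TTheory GRing.Theory Num.Theory.
Local Open Scope classical_set_scope.
Local Open Scope ring_scope.

(** Every probability is finite, so [fine] distributes over the extended-real identity for the
    measure of a union. *)
Lemma fine_prob_setU d (T : measurableType d) (R : realType)
    (P : probability T R) (A B : set T) :
  measurable A -> measurable B ->
  fine (P (A `|` B)) = fine (P A) + fine (P B) - fine (P (A `&` B)).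
Proof.
move=> mA mB.
have fin C : measurable C -> P C \is a fin_num by exact: fin_num_measure.
have mAB : measurable (A `&` B) by exact: measurableI.
rewrite measureUfinl ?ltey_eq ?fin//.
by rewrite fineB ?fineD ?fin_numD ?fin.
Qed.

(** Independence is stated over finite sets of indices; a list without repetitions yields the same
    product as its underlying set. *)
Lemma fine_prob_bigsetI d (T : measurableType d) (R : realType)
    (P : probability T R) (I : finType) (E : I -> set T) (s : seq I) :
  (forall i, measurable (E i)) -> mutually_independent P E -> uniq s ->
  fine (P (\big[setI/setT]_(i <- s) E i)) = \prod_(i <- s) fine (P (E i)).
Proof.
move=> mE indE us.
have fin i : P (E i) \is a fin_num by exact: fin_num_measure.
rewrite -bigcap_seq.
have -> : [set` s] = [set` [set i in s]%SET].
  by apply/seteqP; split=> i /=; rewrite inE.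
rewrite indE (eq_bigl (mem s)) => [|i]; last by rewrite inE.
rewrite -(big_uniq _ us)/=.
rewrite (eq_bigr (fun i => (fine (P (E i)))%:E)) => [|i _]; last by rewrite fineK.
by rewrite prodEFin.
Qed.

(** Equality of arcs is inherited from ['I_5] through [inord], which simplification does not
    evaluate; this table makes [undup] and [uniq] computable on explicit lists of arcs. *)
Lemma bridge_arc_eqE (a b : bridge_arc) :
  (a == b) = match a, b with
             | S1, S1 | S2, S2 | S3, S3 | S4, S4 | S5, S5 => true
             | _, _ => false
             end.
Proof. by case: a; case: b; apply/eqP. Qed.

Lemma functional_onE d (T : measurableType d) (R : realType) (N : network)
    (up : component N -> R -> set T) (e : component N) (t : R) :
  (forall e s s', 0 <= s -> s <= s' -> up e s' `<=` up e s) ->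
  0 <= t -> functional_on up e t = up e t.
Proof.
move=> mono t0; apply/seteqP; split=> w /=; first by apply; rewrite t0 lexx.
by move=> upw s /andP[s0 st]; exact: mono upw.
Qed.

Theorem theorem3p1 (d : measure_display) (T : measurableType d) (R : realType)
    (P : probability T R) (up : component bridge -> R -> set T)
    (up_measurable : forall e s, 0 <= s -> measurable (up e s))
    (failed_stays_failed : forall e s s', 0 <= s -> s <= s' ->
      up e s' `<=` up e s)
    (arcs_independent : forall t, 0 <= t ->
      mutually_independent P (fun e => functional_on up e t))
    (t : R) (t_ge0 : 0 <= t) :
  let R1 := arc_reliability P up S1 t in
  let R2 := arc_reliability P up S2 t in
  let R3 := arc_reliability P up S3 t in
  let R4 := arc_reliability P up S4 t in
  let R5 := arc_reliability P up S5 t in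
  system_reliability P up t =
    R1 * R4 + R2 * R5 + R2 * R3 * R4
    - R1 * R2 * R3 * R4 - R1 * R2 * R4 * R5 - R2 * R3 * R4 * R5
    + R1 * R2 * R3 * R4 * R5.
Proof.
set E := fun e => functional_on up e t.
have mE e : measurable (E e).
  by rewrite /E functional_onE//; exact: up_measurable.
pose F (s : seq bridge_arc) := \big[setI/setT]_(e <- s) E e.
have mF s : measurable (F s) by exact: bigsetI_measurable.
have PF s : uniq s -> fine (P (F s)) = \prod_(e <- s) fine (P (E e)).
  by apply: fine_prob_bigsetI => //; exact: arcs_independent.
(* Intersecting path events merges their arc lists. [undup] keeps a shared arc once, so its
   reliability enters to the first power only. *)
have FI s s' : F s `&` F s' = F (undup (s ++ s')).
  rewrite /F -!bigcap_seq -bigcap_setU; congr (\bigcap_(e in _) _).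
  by apply/seteqP; split=> e /=; rewrite mem_undup mem_cat => /orP.
have sysE : [set w | @successful bridge [set e | functional_on up e t w]] =
    F [:: S1; S4] `|` F [:: S2; S5] `|` F [:: S2; S3; S4].
  apply/seteqP; split=> w /=; rewrite successful_bridge /F !big_cons !big_nil /=.
    by case=> [[]|[]|[]] *; [left; left|left; right|right].
  by case=> [[]|]; [case=> ? []|case=> ? []|case=> ? [? []]] => *;
    [constructor 1|constructor 2|constructor 3].
move=> R1 R2 R3 R4 R5.
rewrite /system_reliability sysE fine_prob_setU//; last exact: measurableU.
(* Distributing the third path event over the union of the first two yields another union of two
   events, which completes the seven terms. *)
rewrite fine_prob_setU// setIUl fine_prob_setU//; try exact: measurableI.
(* The pairwise intersections become lists of four arcs, the triple one the list of all five. *)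
rewrite !FI /= !inE !bridge_arc_eqE /= !inE !bridge_arc_eqE /=.
rewrite !PF /= ?inE ?bridge_arc_eqE//.
rewrite !big_cons !big_nil /R1 /R2 /R3 /R4 /R5 /arc_reliability /E.
ring.
Qed.
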